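(* Let $\mathcal E$ be an elementary topos with subobject classifier $\top:1\to\Omega$. The commutative triangle consisting of the (domain) fibrations $\mathcal E_{/1}\to\mathcal E$ and $\omega:\mathcal E_{/\Omega}\to\mathcal E$ and the functor $\Sigma_\top:\mathcal E_{/1}\to\mathcal E_{/\Omega}$ given by composition with $\top$, together with the functor $\Delta_\top:\mathcal E_{/\Omega}\to\mathcal E_{/1}$ given by pullback along $\top$, is a plain dependent type theory; in particular $\Sigma_\top\dashv\Delta_\top$.
   Context: Plain dependent type theory (pDTT): a category $\mathbf{ctx}$ (with terminal object), fibrations $u:\mathcal U\to\mathbf{ctx}$ and $\dot u:\dot{\mathcal U}\to\mathbf{ctx}$, a functor $\Sigma:\dot{\mathcal U}\to\mathcal U$ with $u\Sigma=\dot u$, and a right adjoint $\Delta:\mathcal U\to\dot{\mathcal U}$ of $\Sigma$ (not required to commute with the projections to $\mathbf{ctx}$), with unit $\eta$ and counit $\epsilon$, such that $\Sigma$ and $\Delta$ preserve cartesian morphisms and the components of $\eta$ and $\epsilon$ are cartesian (for $\dot u$ and $u$ respectively). $\Delta_\top$ sends $\phi:X\to\Omega$ to the pullback object $\{x\mid\phi(x)\}$ of $\top$ along $\phi$. *)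

(* Defs.v *)
From Stdlib Require Import ProofIrrelevance.

Set Implicit Arguments.
Unset Strict Implicit.
Unset Printing Implicit Defensive.

Declare Scope cat_scope.
Delimit Scope cat_scope with cat.
Open Scope cat_scope.

Record Category := {
  ob :> Type;
  hom : ob -> ob -> Type;
  idm : forall x, hom x x;
  comp : forall x y z, hom y z -> hom x y -> hom x z;
  comp_idl : forall x y (f : hom x y), comp (idm y) f = f;
  comp_idr : forall x y (f : hom x y), comp f (idm x) = f;
  comp_assoc : forall w x y z (h : hom y z) (g : hom x y) (f : hom w x),
    comp h (comp g f) = comp (comp h g) f
}.
Arguments hom {c} _ _.
Arguments idm {c} _.
Arguments comp {c x y z} _ _.
Notation "g ∘ f" := (comp g f) (at level 40, left associativity) : cat_scope.

Record Functor (C D : Category) := {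
  fobj :> C -> D;
  fmap : forall x y, hom x y -> hom (fobj x) (fobj y);
  fmap_id : forall x, fmap (idm x) = idm (fobj x);
  fmap_comp : forall x y z (g : hom y z) (f : hom x y),
    fmap (g ∘ f) = fmap g ∘ fmap f
}.
Arguments fmap {C D} _ {x y} _.

Definition functor_id (C : Category) : Functor C C := {|
  fobj := fun x => x;
  fmap := fun x y f => f;
  fmap_id := fun x => eq_refl;
  fmap_comp := fun x y z g f => eq_refl
|}.

Definition functor_comp (C D E : Category) (G : Functor D E) (F : Functor C D) :
  Functor C E.
Proof.
refine {| fobj := fun x => G (F x); fmap := fun x y f => fmap G (fmap F f) |}.
- intros x; now rewrite !fmap_id.
- intros x y z g f; now rewrite !fmap_comp.
Defined.

Record NatTrans (C D : Category) (F G : Functor C D) := {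
  component :> forall x, hom (F x) (G x);
  naturality : forall x y (f : hom x y),
    component y ∘ fmap F f = fmap G f ∘ component x
}.

Record Adjunction (C D : Category) (L : Functor C D) (R : Functor D C) := {
  adj_unit : NatTrans (functor_id C) (functor_comp R L);
  adj_counit : NatTrans (functor_comp L R) (functor_id D);
  triangle_left : forall x, adj_counit (L x) ∘ fmap L (adj_unit x) = idm (L x);
  triangle_right : forall y, fmap R (adj_counit y) ∘ adj_unit (R y) = idm (R y)
}.

Definition is_cartesian (E B : Category) (p : Functor E B) (e' e : E)
    (phi : hom e' e) : Prop :=
  forall (e'' : E) (psi : hom e'' e) (g : hom (p e'') (p e')),
    fmap p phi ∘ g = fmap p psi ->
    exists! chi : hom e'' e', fmap p chi = g /\ phi ∘ chi = psi.

(* Grothendieck fibration: the cartesian lift lies over [f] on the nose, hence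
   the transport along the equality of objects [q]. *)
Definition is_fibration (E B : Category) (p : Functor E B) : Prop :=
  forall (e : E) (b : B) (f : hom b (p e)),
    exists (e' : E) (q : p e' = b) (phi : hom e' e),
      eq_rect (p e') (fun x => hom x (p e)) (fmap p phi) b q = f /\
      is_cartesian p phi.

(* [F] sends [p]-cartesian morphisms to [q]-cartesian ones.  The base categories
   play no role, so [F] need not commute with [p] and [q]. *)
Definition preserves_cartesian (E E' B B' : Category) (p : Functor E B)
    (q : Functor E' B') (F : Functor E E') : Prop :=
  forall (x y : E) (f : hom x y), is_cartesian p f -> is_cartesian q (fmap F f).

Record Terminal (C : Category) := {
  term_ob :> C;
  bang : forall x, hom x term_ob;
  bang_unique : forall x (f : hom x term_ob), f = bang x
}.

Record is_plain_dtt (ctx U Udot : Category)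
    (u : Functor U ctx) (udot : Functor Udot ctx)
    (Sigma : Functor Udot U) (Delta : Functor U Udot)
    (adj : Adjunction Sigma Delta) : Prop := {
  pdtt_terminal : inhabited (Terminal ctx);
  pdtt_fibration : is_fibration u;
  pdtt_fibration_dot : is_fibration udot;
  pdtt_triangle : functor_comp u Sigma = udot;
  pdtt_Sigma_cartesian : preserves_cartesian udot u Sigma;
  pdtt_Delta_cartesian : preserves_cartesian u udot Delta;
  pdtt_unit_cartesian : forall x : Udot, is_cartesian udot (adj_unit adj x);
  pdtt_counit_cartesian : forall y : U, is_cartesian u (adj_counit adj y)
}.

Record Product (C : Category) (a b : C) := {
  prod_ob :> C;
  prod_fst : hom prod_ob a;
  prod_snd : hom prod_ob b;
  prod_pair : forall x, hom x a -> hom x b -> hom x prod_ob;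
  prod_pair_fst : forall x (h : hom x a) (k : hom x b),
    prod_fst ∘ prod_pair h k = h;
  prod_pair_snd : forall x (h : hom x a) (k : hom x b),
    prod_snd ∘ prod_pair h k = k;
  prod_unique : forall x (l : hom x prod_ob),
    l = prod_pair (prod_fst ∘ l) (prod_snd ∘ l)
}.

Definition is_pullback (C : Category) (a b c : C) (f : hom a c) (g : hom b c)
    (p : C) (p1 : hom p a) (p2 : hom p b) : Prop :=
  f ∘ p1 = g ∘ p2 /\
  forall (x : C) (h : hom x a) (k : hom x b), f ∘ h = g ∘ k ->
    exists! l : hom x p, p1 ∘ l = h /\ p2 ∘ l = k.

(* The mediating morphism [pb_lift] is determined by [pb_is_pullback]; it is
   kept as data so that pullback functors can be defined without choice. *)
Record Pullback (C : Category) (a b c : C) (f : hom a c) (g : hom b c) := {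
  pb_ob :> C;
  pb_fst : hom pb_ob a;
  pb_snd : hom pb_ob b;
  pb_is_pullback : is_pullback f g pb_fst pb_snd;
  pb_lift : forall x (h : hom x a) (k : hom x b), f ∘ h = g ∘ k -> hom x pb_ob;
  pb_lift_fst : forall x (h : hom x a) (k : hom x b) (e : f ∘ h = g ∘ k),
    pb_fst ∘ pb_lift e = h;
  pb_lift_snd : forall x (h : hom x a) (k : hom x b) (e : f ∘ h = g ∘ k),
    pb_snd ∘ pb_lift e = k
}.

Definition is_mono (C : Category) (a b : C) (m : hom a b) : Prop :=
  forall (x : C) (h k : hom x a), m ∘ h = m ∘ k -> h = k.

Definition is_subobject_classifier (C : Category) (one : Terminal C)
    (Omega : C) (truth : hom (one : C) Omega) : Prop :=
  forall (s b : C) (m : hom s b), is_mono m ->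
    exists! chi : hom b Omega, is_pullback chi truth m (bang one s).

Definition is_exponential (C : Category) (P : forall x y : C, Product x y)
    (a b e : C) (ev : hom (P e a : C) b) : Prop :=
  forall (c : C) (f : hom (P c a : C) b),
    exists! g : hom c e,
      ev ∘ prod_pair (P e a) (g ∘ prod_fst (P c a)) (prod_snd (P c a)) = f.

(* Finite limits are given by a terminal object and pullbacks; the (redundant)
   chosen binary products only serve to express cartesian closure. *)
Record ElementaryTopos := {
  topos_cat :> Category;
  topos_one : Terminal topos_cat;
  topos_prod : forall a b : topos_cat, Product a b;
  topos_pullback : forall (a b c : topos_cat) (f : hom a c) (g : hom b c),
    Pullback f g;
  topos_closed : forall a b : topos_cat,
    exists (e : topos_cat) (ev : hom (topos_prod e a : topos_cat) b),
      is_exponential ev;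
  Omega : topos_cat;
  truth : hom (topos_one : topos_cat) Omega;
  truth_classifies : is_subobject_classifier truth
}.

Record SliceOb (C : Category) (A : C) := {
  slice_dom : C;
  slice_map : hom slice_dom A
}.

Definition SliceHom (C : Category) (A : C) (x y : SliceOb A) : Type :=
  {h : hom (slice_dom x) (slice_dom y) | slice_map y ∘ h = slice_map x}.

Lemma slice_hom_eq (C : Category) (A : C) (x y : SliceOb A)
  (h k : SliceHom x y) : proj1_sig h = proj1_sig k -> h = k.
Proof.
destruct h as [h eh], k as [k ek]; simpl; intros e; subst k.
now rewrite (proof_irrelevance _ eh ek).
Qed.

Definition slice (C : Category) (A : C) : Category.
Proof.
unshelve refine {|
  ob := SliceOb A;
  hom := @SliceHom C A;
  idm := fun x => exist _ (idm (slice_dom x)) (comp_idr (slice_map x));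
  comp := fun x y z g f => exist _ (proj1_sig g ∘ proj1_sig f) _
|}.
- now rewrite comp_assoc, (proj2_sig g), (proj2_sig f).
- intros; apply slice_hom_eq, comp_idl.
- intros; apply slice_hom_eq, comp_idr.
- intros; apply slice_hom_eq, comp_assoc.
Defined.

Definition dom_functor (C : Category) (A : C) : Functor (slice A) C := {|
  fobj := fun x : slice A => slice_dom x;
  fmap := fun (x y : slice A) (h : hom x y) => proj1_sig h;
  fmap_id := fun x => eq_refl;
  fmap_comp := fun x y z g f => eq_refl
|}.

Definition postcomp_functor (C : Category) (A B : C) (f : hom A B) :
  Functor (slice A) (slice B).
Proof.
unshelve refine {|
  fobj := fun x : slice A =>
    {| slice_dom := slice_dom x; slice_map := f ∘ slice_map x |} : slice B;
  fmap := fun (x y : slice A) (h : hom x y) => exist _ (proj1_sig h) _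
|}.
- now simpl; rewrite <- comp_assoc, (proj2_sig h).
- intros; now apply slice_hom_eq.
- intros; now apply slice_hom_eq.
Defined.

Section PullbackFunctor.

Variables (C : Category) (A B : C) (f : hom A B).
Variable pb : forall (X : C) (phi : hom X B), Pullback phi f.

Lemma pb_hom_ext (X Y : C) (phi : hom X B) (h k : hom Y (pb phi)) :
  pb_fst (pb phi) ∘ h = pb_fst (pb phi) ∘ k ->
  pb_snd (pb phi) ∘ h = pb_snd (pb phi) ∘ k -> h = k.
Proof.
intros e1 e2; destruct (pb_is_pullback (pb phi)) as [sq univ].
destruct (univ Y (pb_fst (pb phi) ∘ k) (pb_snd (pb phi) ∘ k)) as [l [_ lu]].
- now rewrite !comp_assoc, sq.
- now rewrite <- (lu h (conj e1 e2)), <- (lu k (conj eq_refl eq_refl)).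
Qed.

Lemma pb_map_square (x y : slice B) (h : hom x y) :
  slice_map y ∘ (proj1_sig h ∘ pb_fst (pb (slice_map x))) =
  f ∘ pb_snd (pb (slice_map x)).
Proof.
rewrite comp_assoc, (proj2_sig h).
exact (proj1 (pb_is_pullback (pb (slice_map x)))).
Qed.

Definition pullback_functor : Functor (slice B) (slice A).
Proof.
unshelve refine {|
  fobj := fun x : slice B =>
    {| slice_dom := pb (slice_map x);
       slice_map := pb_snd (pb (slice_map x)) |} : slice A;
  fmap := fun (x y : slice B) (h : hom x y) =>
    exist _ (pb_lift (pb (slice_map y)) (pb_map_square h)) _
|}.
- apply pb_lift_snd.
- intros x; apply slice_hom_eq, pb_hom_ext; simpl.
  + now rewrite pb_lift_fst, comp_idl, comp_idr.
  + now rewrite pb_lift_snd, comp_idr.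
- intros x y z g h; apply slice_hom_eq, pb_hom_ext; simpl.
  + now rewrite pb_lift_fst, (comp_assoc (pb_fst _)), pb_lift_fst,
      <- !comp_assoc, pb_lift_fst.
  + now rewrite pb_lift_snd, comp_assoc, !pb_lift_snd.
Defined.

End PullbackFunctor.

Definition Sigma_top (E : ElementaryTopos) :
    Functor (slice (topos_one E : E)) (slice (Omega E)) :=
  postcomp_functor (truth E).

Definition Delta_top (E : ElementaryTopos) :
    Functor (slice (Omega E)) (slice (topos_one E : E)) :=
  pullback_functor (fun X (phi : hom X (Omega E)) =>
    topos_pullback phi (truth E)).

(* Main.v *)
From Stdlib Require Import ProofIrrelevance.
Require Import Defs.

Set Implicit Arguments.
Unset Strict Implicit.
Unset Printing Implicit Defensive.

(** The domain projection of a slice category is a discrete fibration: a map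
    into the domain of an object over [A] lifts in exactly one way, by composing
    structure maps.  Hence every morphism of the slice is cartesian, and all the
    cartesianness conditions hold automatically.  What remains is the
    adjunction between composition and pullback along a morphism. *)

Lemma dom_functor_cartesian (C : Category) (A : C) (x y : slice A)
    (h : hom x y) : is_cartesian (dom_functor A) h.
Proof.
intros z psi g e; simpl in e, g.
(* Since [h] and [psi] lie over [A], both sides equal [slice_map y ∘ h ∘ g]; so [g] itself is the
   lift. *)
assert (eg : slice_map x ∘ g = slice_map z).
{ now rewrite <- (proj2_sig h), <- comp_assoc, e, (proj2_sig psi). }
exists (exist _ g eg : hom z x); split.
- split; [reflexivity | now apply slice_hom_eq].
- intros chi [echi _]; apply slice_hom_eq; symmetry; exact echi.
Qed.

Lemma dom_functor_fibration (C : Category) (A : C) :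
  is_fibration (dom_functor A).
Proof.
intros e b f.
(* The lift has domain [b] on the nose, so the transport is trivial. *)
exists ({| slice_dom := b; slice_map := slice_map e ∘ f |} : slice A), eq_refl.
exists (exist (fun h => slice_map e ∘ h = slice_map e ∘ f) f eq_refl).
split; [reflexivity | apply dom_functor_cartesian].
Qed.

(** Objects and arrows agree by computation; only the proofs of the functor laws can differ. *)
Lemma dom_functor_postcomp (C : Category) (A B : C) (f : hom A B) :
  functor_comp (dom_functor B) (postcomp_functor f) = dom_functor A.
Proof. unfold dom_functor, functor_comp; f_equal; apply proof_irrelevance. Qed.

Section PostcompPullbackAdjunction.

Variables (C : Category) (A B : C) (f : hom A B).
Variable pb : forall (X : C) (phi : hom X B), Pullback phi f.

(** The cone with legs [idm] and [slice_map x], whose mediating map is the unit at [x]. *)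
Lemma postcomp_unit_square (x : slice A) :
  (f ∘ slice_map x) ∘ idm (slice_dom x) = f ∘ slice_map x.
Proof. apply comp_idr. Qed.

Definition postcomp_unit_component (x : slice A) :
    hom x (pullback_functor pb (postcomp_functor f x)) :=
  exist _ (pb_lift (pb (f ∘ slice_map x)) (postcomp_unit_square x))
    (pb_lift_snd _ _).

Definition postcomp_counit_component (y : slice B) :
    hom (postcomp_functor f (pullback_functor pb y)) y :=
  exist _ (pb_fst (pb (slice_map y)))
    (proj1 (pb_is_pullback (pb (slice_map y)))).

Definition postcomp_unit :
  NatTrans (functor_id (slice A))
    (functor_comp (pullback_functor pb) (postcomp_functor f)).
Proof.
refine {| component := postcomp_unit_component
  : forall x, hom (functor_id (slice A) x) (functor_comp _ _ x) |}.
(* Both composites have first projection [h] and second projection [slice_map x]. *)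
intros x y h; apply slice_hom_eq, pb_hom_ext; simpl.
- now rewrite !(comp_assoc (pb_fst _)), !pb_lift_fst, <- (comp_assoc (proj1_sig h)),
    pb_lift_fst, comp_idl, comp_idr.
- now rewrite !(comp_assoc (pb_snd _)), !pb_lift_snd, (proj2_sig h).
Defined.

Definition postcomp_counit :
  NatTrans (functor_comp (postcomp_functor f) (pullback_functor pb))
    (functor_id (slice B)).
Proof.
refine {| component := postcomp_counit_component
  : forall y, hom (functor_comp _ _ y) (functor_id (slice B) y) |}.
intros x y h; apply slice_hom_eq; simpl; apply pb_lift_fst.
Defined.

Definition postcomp_pullback_adjunction :
  Adjunction (postcomp_functor f) (pullback_functor pb).
Proof.
refine {| adj_unit := postcomp_unit; adj_counit := postcomp_counit |}.
(* The unit was built as a section of [pb_fst], which is the counit. *)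
- intros x; apply slice_hom_eq; simpl; apply pb_lift_fst.
- intros y; apply slice_hom_eq, pb_hom_ext; simpl.
  + now rewrite (comp_assoc (pb_fst _)), pb_lift_fst, <- comp_assoc, pb_lift_fst.
  + now rewrite (comp_assoc (pb_snd _)), !pb_lift_snd, comp_idr.
Defined.

End PostcompPullbackAdjunction.

Theorem mainTheorem13 (E : ElementaryTopos) :
  exists adj : Adjunction (Sigma_top E) (Delta_top E),
    is_plain_dtt (dom_functor (Omega E)) (dom_functor (topos_one E : E)) adj.
Proof.
(* The case [f := truth E], with the same chosen pullbacks that define [Delta_top]. *)
exists (postcomp_pullback_adjunction (fun X (phi : hom X (Omega E)) =>
  topos_pullback phi (truth E))).
split.
- exact (inhabits (topos_one E)).
- apply dom_functor_fibration.
- apply dom_functor_fibration.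
- apply dom_functor_postcomp.
- intros x y h _; apply dom_functor_cartesian.
- intros x y h _; apply dom_functor_cartesian.
- intros x; apply dom_functor_cartesian.
- intros y; apply dom_functor_cartesian.
Qed.
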